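(* Let $d$ be a nonnegative integer. Let $A$ (resp. $A^*$) be a diagonalizable linear transformation on $V$ with eigenvalues $\{\theta_i\}_{i=0}^d$ (resp. $\{\theta^*_i\}_{i=0}^d$). Suppose that the pair $(A,A^* )$ is irreducible, and Hessenberg with respect to $(\{\theta_i\}_{i=0}^d;\{\theta^*_i\}_{i=0}^d)$. Then there exists an $(A,A^* )$-split decomposition of $V$ with respect to $(\{\theta_i\}_{i=0}^d;\{\theta^*_i\}_{i=0}^d)$.
   Context: $\mathbb K$ is a field and $V$ is a nonzero finite-dimensional vector space over $\mathbb K$. A linear transformation on $V$ is a $\mathbb K$-linear map $V\to V$; it is diagonalizable if $V$ is spanned by its eigenspaces. $A$ and $A^*$ are arbitrary linear transformations ($A^*$ does not denote an adjoint or conjugate-transpose). Saying that $A$ has eigenvalues $\{\theta_i\}_{i=0}^d$ means that $\theta_0,\dots,\theta_d$ is an ordering, without repetition, of all the distinct eigenvalues of $A$; similarly for $A^*$. Irreducible: the pair $(A,A^* )$ is irreducible if there is no subspace $W$ of $V$ with $AW\subseteq W$, $A^*W\subseteq W$, $W\ne 0$, $W\ne V$. Hessenberg: let $V_i$ be the eigenspace of $A$ for $\theta_i$ and $V^*_i$ the eigenspace of $A^*$ for $\theta^*_i$ ($0\le i\le d$), and set $V_{d+1}=0$, $V^*_{d+1}=0$. The pair $(A,A^* )$ is Hessenberg with respect to $(\{\theta_i\}_{i=0}^d;\{\theta^*_i\}_{i=0}^d)$ if for all $0\le i\le d$ both $A^*V_i\subseteq V_0+V_1+\cdots+V_{i+1}$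 and $AV^*_i\subseteq V^*_0+V^*_1+\cdots+V^*_{i+1}$. Split decomposition: a decomposition of $V$ is a sequence $\{U_i\}_{i=0}^d$ of nonzero subspaces of $V$ such that $V=U_0+U_1+\cdots+U_d$ is a direct sum; set $U_{-1}=0$, $U_{d+1}=0$. An $(A,A^* )$-split decomposition of $V$ with respect to $(\{\theta_i\}_{i=0}^d;\{\theta^*_i\}_{i=0}^d)$ is a decomposition $\{U_i\}_{i=0}^d$ of $V$ such that for all $0\le i\le d$ both $(A-\theta_{d-i}I)U_i\subseteq U_{i+1}$ and $(A^*-\theta^*_iI)U_i\subseteq U_{i-1}$. *)

(* Defs.v *)
From HB Require Import structures.
From mathcomp Require Import all_boot all_order all_algebra.

Set Implicit Arguments.
Unset Strict Implicit.
Unset Printing Implicit Defensive.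

Import GRing.Theory passmx.
Local Open Scope ring_scope.

Section HessenbergPairs.

Variables (K : fieldType) (V : vectType K).
Implicit Types (A B : 'End(V)) (W : {vspace V}).

(* As V has finite dimension, it is spanned by all the eigenspaces of A iff it
   is the sum of finitely many of them. *)
Definition diagonalizable_end A : Prop :=
  exists s : seq K, (\sum_(a <- s) leigenspace A a)%VS = fullv.

Definition has_eigenvalues d A (theta : 'I_d.+1 -> K) : Prop :=
  injective theta /\
  forall a : K, leigenvalue A a <-> exists i : 'I_d.+1, theta i = a.

Definition irreducible_pair A B : Prop :=
  ~ exists W, [/\ (A @: W <= W)%VS, (B @: W <= W)%VS, W != 0%VS & W != fullv].

(* U_0, ..., U_d extended by the convention U_k = 0 for every other integer k. *)
Definition extend0 d (U : 'I_d.+1 -> {vspace V}) (k : int) : {vspace V} :=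
  if k is Posz n then oapp U 0%VS (insub n) else 0%VS.

Definition hessenberg_pair d A B (theta thetas : 'I_d.+1 -> K) : Prop :=
  let E := extend0 (fun i => leigenspace A (theta i)) in
  let Es := extend0 (fun i => leigenspace B (thetas i)) in
  forall i : 'I_d.+1,
    (B @: E i <= \sum_(j < i.+2) E j)%VS /\
    (A @: Es i <= \sum_(j < i.+2) Es j)%VS.

Definition decomposition d (U : 'I_d.+1 -> {vspace V}) : Prop :=
  [/\ forall i, U i != 0%VS,
      (\sum_i U i)%VS = fullv
    & directv (\sum_i U i)%VS].

(* [rev_ord i] is the index d - i. *)
Definition split_decomposition d A B (theta thetas : 'I_d.+1 -> K)
    (U : 'I_d.+1 -> {vspace V}) : Prop :=
  decomposition U /\
  forall i : 'I_d.+1,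
    ((A - theta (rev_ord i) *: \1%VF)%R @: U i <= extend0 U (i%:Z + 1))%VS /\
    ((B - thetas i *: \1%VF)%R @: U i <= extend0 U (i%:Z - 1))%VS.

End HessenbergPairs.

(* Main.v *)
Require Import Defs.
From HB Require Import structures.
From mathcomp Require Import all_boot all_order all_algebra.
From mathcomp Require Import zify.

Set Implicit Arguments.
Unset Strict Implicit.
Unset Printing Implicit Defensive.

(** Put F_i = V_0 + ... + V_(i-1) and G_i = V*_0 + ... + V*_(i-1).  Each of the
    flags F and G is lowered by the shifts of its own transformation and raised
    by at most one step by the other one.  Hence for fixed r the spaces
    F_(r+1-k) :&: G_(k+1), for k = 0, ..., r, are moved one step up by the shifts
    of A and one step down by those of A*, so that the sum of the first i of them
    is invariant as soon as the i-th one vanishes; being contained in G_i, this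
    sum is then 0 by irreducibility when i <= d.  For r < d and i = r + 1 this
    says that all these intersections vanish.  For r = d it says that none of them
    does, and they form the required split decomposition: the sum of all of them
    is a nonzero invariant subspace, and it is direct because the vanishing for
    r = d - 1 makes each term meet the sum of the previous ones trivially. *)

(** * Shifts by a scalar, eigenspaces, and directness of sums *)

Section LinearMaps.

Import GRing.Theory passmx.
Local Open Scope ring_scope.

Variables (K : fieldType) (V : vectType K).
Implicit Types (A B : 'End(V)) (W X : {vspace V}).

(** The two images differ by multiples of vectors of [W], which already lie in [X]. *)
Lemma limg_shift A c W X : (W <= X)%VS ->
  ((A - c *: \1%VF) @: W <= X)%VS = (A @: W <= X)%VS.
Proof.
move=> /subvP sWX; have shiftE v : (A - c *: \1%VF) v = A v - c *: v.
  by rewrite add_lfunE opp_lfunE scale_lfunE id_lfunE.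
apply/subvP/subvP => sAW _ /memv_imgP[v Wv ->].
  rewrite -[A v](subrK (c *: v)) -shiftE.
  by apply: memvD; [apply: sAW; apply: memv_img | apply/memvZ/sWX].
rewrite shiftE.
by apply: memvB; [apply: sAW; apply: memv_img | apply/memvZ/sWX].
Qed.

Lemma memv_leigenspace A c v : (v \in leigenspace A c) = (A v == c *: v).
Proof.
by rewrite memv_ker add_lfunE opp_lfunE scale_lfunE id_lfunE subr_eq0.
Qed.

Lemma limg_leigenspace A c : (A @: leigenspace A c <= leigenspace A c)%VS.
Proof.
apply/subvP=> _ /memv_imgP[v Wv ->]; move: (Wv).
by rewrite memv_leigenspace => /eqP ->; rewrite memvZ.
Qed.

Lemma extend0_ord d (U : 'I_d.+1 -> {vspace V}) (i : 'I_d.+1) :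
  extend0 U i%:Z = U i.
Proof. by rewrite /extend0 insubT ?ltn_ord //= => lt_id; congr U; apply: val_inj. Qed.

Lemma extend0_gt d (U : 'I_d.+1 -> {vspace V}) n :
  (d < n)%N -> extend0 U n%:Z = 0%VS.
Proof. by move=> lt_dn; rewrite /extend0 insubF // ltnS leqNgt lt_dn. Qed.

Lemma directv_sum_nat n (U : nat -> {vspace V}) :
    (forall i, (i < n)%N -> ((\sum_(j < i) U j) :&: U i = 0)%VS) ->
  directv (\sum_(i < n) U i)%VS.
Proof.
move=> capU; rewrite directvE /=; apply/eqP.
elim: n capU => [|n IHn] capU; first by rewrite !big_ord0 dimv0.
rewrite !big_ord_recr /= dimv_disjoint_sum ?capU //.
by rewrite IHn // => i lt_in; rewrite capU // ltnS ltnW.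
Qed.

End LinearMaps.

(** * The flag spanned by the leading eigenspaces of one map *)

Section EigenFlag.

Import GRing.Theory passmx.
Local Open Scope ring_scope.

Variables (K : fieldType) (V : vectType K) (d : nat).
Variables (A : 'End(V)) (theta : 'I_d.+1 -> K).

Let E := extend0 (fun i => leigenspace A (theta i)).

(** The zero padding in [E] keeps the flag constant from [d.+1] on, so [n] needs no bound. *)
Definition eigenflag n : {vspace V} := (\sum_(j < n) E j)%VS.

Lemma eigenflag0 : eigenflag 0 = 0%VS.
Proof. by rewrite /eigenflag big_ord0. Qed.

Lemma eigenflagS n : eigenflag n.+1 = (eigenflag n + E n)%VS.
Proof. by rewrite /eigenflag big_ord_recr. Qed.

Lemma eigenflag_leq m n : (m <= n)%N -> (eigenflag m <= eigenflag n)%VS.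
Proof.
move=> le_mn; apply/subv_sumP=> i _.
by rewrite (sumv_sup (widen_ord le_mn i)).
Qed.

Lemma eigenflag1_neq0 : has_eigenvalues A theta -> eigenflag 1 != 0%VS.
Proof.
case=> _ eigA; rewrite /eigenflag big_ord1 [E _](extend0_ord _ ord0).
by apply/eigA; exists ord0.
Qed.

(** The spanning list [s] may contain scalars that are not eigenvalues; these contribute 0, and the
    others are among the [theta i]. *)
Lemma eigenflag_full :
  diagonalizable_end A -> has_eigenvalues A theta -> eigenflag d.+1 = fullv.
Proof.
case=> s sumE [_ eigA]; apply/eqP; rewrite eqEsubv subvf -sumE /=.
elim/big_rec: _ => [|a W _ sWF]; first exact: sub0v.
rewrite subv_add sWF andbT; have [->|/eigA[i <-]] := eqVneq (leigenspace A a) 0%VS.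
  exact: sub0v.
by rewrite (sumv_sup i) // [E i]extend0_ord.
Qed.

Lemma limg_eigenflag_shift (i : 'I_d.+1) :
  ((A - theta i *: \1%VF) @: eigenflag i.+1 <= eigenflag i)%VS.
Proof.
rewrite eigenflagS limgD subv_add; apply/andP; split; last first.
  have : (E i <= lker (A - theta i *: \1%VF))%VS by rewrite [E i]extend0_ord.
  by rewrite lkerE => /eqP ->; rewrite sub0v.
rewrite limg_shift // limg_sum; apply/subv_sumP=> j _.
rewrite (sumv_sup j) //; have lt_jd : (j < d.+1)%N by apply: ltn_trans (ltn_ord i).
have -> : E j = leigenspace A (theta (Ordinal lt_jd)).
  exact: (extend0_ord _ (Ordinal lt_jd)).
exact: limg_leigenspace.
Qed.

(** An eigenvector for the last eigenvalue avoids the flag: the shift by [theta n] lowers the flag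
    but only rescales the vector by a nonzero factor, so the vector would descend to
    [eigenflag 0]. *)
Lemma eigenflag_proper n :
  has_eigenvalues A theta -> (n <= d)%N -> eigenflag n != fullv.
Proof.
case=> inj_theta eigA le_nd; apply/eqP=> flag_full.
have: leigenspace A (theta ord_max) != 0%VS by apply/eigA; exists ord_max.
case/negP; rewrite -subv0; apply/subvP=> v Ev; rewrite memv0.
move: Ev; rewrite memv_leigenspace => /eqP Av.
have: v \in eigenflag n by rewrite flag_full memvf.
elim: n le_nd {flag_full} => [|n IHn] lt_nd; first by rewrite eigenflag0 memv0.
move=> Fv; apply: IHn; first exact: ltnW.
have lt_nd1 : (n < d.+1)%N by apply: ltnW.
have /subvP/(_ _ (memv_img _ Fv)) := limg_eigenflag_shift (Ordinal lt_nd1).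
rewrite add_lfunE opp_lfunE scale_lfunE id_lfunE Av -scalerBl.
move/(memvZ (theta ord_max - theta (Ordinal lt_nd1))^-1); rewrite scalerK //.
by rewrite subr_eq0 (inj_eq inj_theta) -val_eqE /= gtn_eqF.
Qed.

Lemma limg_eigenflag (B : 'End(V)) n :
    (forall i : 'I_d.+1, (B @: E i <= eigenflag i.+2)%VS) ->
  (B @: eigenflag n <= eigenflag n.+1)%VS.
Proof.
move=> BE; rewrite limg_sum; apply/subv_sumP=> i _.
have [lt_id|le_di] := ltnP i d.+1; last by rewrite [E i]extend0_gt // limg0 sub0v.
apply: subv_trans (BE (Ordinal lt_id)) _.
by apply: eigenflag_leq; apply: (ltn_ord i).
Qed.

End EigenFlag.

(** * Intersections of two flags that the maps move in opposite directions *)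

Section SplitDecomposition.

Local Open Scope ring_scope.

Variables (K : fieldType) (V : vectType K) (A B : 'End(V)) (d : nat).
Variables (F G : nat -> {vspace V}) (a b : nat -> K).

Hypothesis irr : irreducible_pair A B.
Hypothesis F0 : F 0 = 0%VS.
Hypothesis G0 : G 0 = 0%VS.
Hypothesis F_full : F d.+1 = fullv.
Hypothesis G1_neq0 : G 1 != 0%VS.
Hypothesis G_proper : forall i, (i <= d)%N -> G i != fullv.
Hypothesis F_leq : forall i j, (i <= j)%N -> (F i <= F j)%VS.
Hypothesis G_leq : forall i j, (i <= j)%N -> (G i <= G j)%VS.
Hypothesis AF :
  forall i, (i <= d)%N -> ((A - a i *: \1%VF) @: F i.+1 <= F i)%VS.
Hypothesis BG :
  forall i, (i <= d)%N -> ((B - b i *: \1%VF) @: G i.+1 <= G i)%VS.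
Hypothesis AG : forall i, (A @: G i <= G i.+1)%VS.
Hypothesis BF : forall i, (B @: F i <= F i.+1)%VS.

(* The intersection of V_0 + ... + V_(r-k) and V*_0 + ... + V*_k; it is 0 for
   k = r.+1, thanks to F 0 = 0. *)
Definition flag_cap r k : {vspace V} := (F (r.+1 - k) :&: G k.+1)%VS.

Lemma flag_cap_ge r k : (r < k)%N -> flag_cap r k = 0%VS.
Proof. by rewrite /flag_cap -subn_eq0 => /eqP ->; rewrite F0 cap0v. Qed.

(** The scalar is the one that lowers [F (r - k).+1]; on the side of [G], which is raised, any
    scalar would do. *)
Lemma flag_cap_up r k : (k <= r <= d)%N ->
  ((A - a (r - k) *: \1%VF) @: flag_cap r k <= flag_cap r k.+1)%VS.
Proof.
case/andP=> le_kr le_rd; rewrite /flag_cap subSS subSn // subv_cap.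
rewrite (subv_trans (limgS _ (capvSl _ _))) ?AF ?(leq_trans (leq_subr _ _)) //=.
rewrite (subv_trans (limgS _ (capvSr _ _))) // limg_shift ?AG //.
exact: G_leq.
Qed.

Lemma flag_cap_down r k : (k <= r <= d)%N ->
  ((B - b k *: \1%VF) @: flag_cap r k <=
     if k is k'.+1 then flag_cap r k' else 0%VS)%VS.
Proof.
case/andP=> le_kr le_rd; have le_kd := leq_trans le_kr le_rd.
have downG : ((B - b k *: \1%VF) @: flag_cap r k <= G k)%VS.
  exact: subv_trans (limgS _ (capvSr _ _)) (BG le_kd).
case: k le_kr le_kd downG => [|k] lt_kr le_kd downG; first by rewrite -G0.
rewrite {2}/flag_cap subv_cap downG andbT.
apply: subv_trans (limgS _ (capvSl _ _)) _; rewrite limg_shift.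
  apply: subv_trans (BF _) (F_leq _); lia.
by apply: F_leq; rewrite leq_sub2l.
Qed.

Lemma flag_cap_sum_sub r i : (\sum_(k < i) flag_cap r k <= G i)%VS.
Proof.
apply/subv_sumP=> k _.
exact: subv_trans (capvSr _ _) (G_leq (ltn_ord k)).
Qed.

Lemma flag_cap_sum_invariant r i : (i <= r.+1)%N -> (r <= d)%N ->
    flag_cap r i = 0%VS ->
  let W := (\sum_(k < i) flag_cap r k)%VS in
  (A @: W <= W)%VS /\ (B @: W <= W)%VS.
Proof.
move=> le_ir le_rd cap0 W.
have capW k : (k < i)%N -> (flag_cap r k <= W)%VS.
  by move=> lt_ki; rewrite /W (sumv_sup (Ordinal lt_ki)).
rewrite {1 3}/W !limg_sum; split; apply/subv_sumP=> k _.
  (* Each term lies in [W], so invariance can be tested with a scalar chosen for that term. *)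
  rewrite -(limg_shift _ (a (r - k))) ?capW //.
  apply: subv_trans (flag_cap_up _) _.
    by rewrite le_rd andbT -ltnS (leq_trans (ltn_ord k)).
  have [/capW //|le_ik] := ltnP k.+1 i.
  by have -> : k.+1 = i; [apply/eqP; rewrite eqn_leq ltn_ord|rewrite cap0 sub0v].
rewrite -(limg_shift _ (b k)) ?capW //.
apply: subv_trans (flag_cap_down _) _.
  by rewrite le_rd andbT -ltnS (leq_trans (ltn_ord k)).
by case: k => [[|k] /= lt_ki]; rewrite ?sub0v // capW // ltnW.
Qed.

Lemma flag_cap_sum_eq0 r i : (i <= r.+1)%N -> (r <= d)%N -> (i <= d)%N ->
  flag_cap r i = 0%VS -> (\sum_(k < i) flag_cap r k)%VS = 0%VS.
Proof.
move=> le_ir le_rd le_id /(flag_cap_sum_invariant le_ir le_rd)[AW BW].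
apply/eqP/negPn/negP => W_neq0; apply: irr.
exists (\sum_(k < i) flag_cap r k)%VS; split=> //.
apply: contraNneq (G_proper le_id) => W_full.
by rewrite eqEsubv subvf -W_full flag_cap_sum_sub.
Qed.

(** The term of index 0 is [G 1], which is nonzero; if a later term vanished, the sum before it,
    which contains [G 1], would be 0. *)
Lemma flag_cap_neq0 i : (i <= d)%N -> flag_cap d i != 0%VS.
Proof.
have cap_d0 : flag_cap d 0 = G 1 by rewrite /flag_cap subn0 F_full capfv.
move=> le_id; apply/eqP => cap0; case: i le_id cap0 => [|i] le_id cap0.
  by case/eqP: G1_neq0; rewrite -cap_d0.
case/eqP: G1_neq0; apply/eqP; rewrite -subv0 -cap_d0.
by rewrite -(flag_cap_sum_eq0 _ _ le_id cap0) ?(sumv_sup ord0) // leqW.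
Qed.

Lemma flag_cap_sum_full : (\sum_(k < d.+1) flag_cap d k)%VS = fullv.
Proof.
(* The term of index [d.+1] vanishes because it involves [F 0]. *)
have [|AW BW] := flag_cap_sum_invariant (leqnn d.+1) (leqnn d).
  exact: flag_cap_ge.
apply/eqP/negPn/negP => W_proper; apply: irr.
exists (\sum_(k < d.+1) flag_cap d k)%VS; split=> //.
rewrite -subv0; apply: contra (flag_cap_neq0 (leq0n d)) => W0.
by rewrite -subv0 (subv_trans _ W0) // (sumv_sup ord0).
Qed.

(** The term of index [i.+1] lies in [F (d - i)] and the sum of the earlier ones in [G i.+1]; these
    two spaces meet in [flag_cap d.-1 i]. *)
Lemma flag_cap_directv : directv (\sum_(k < d.+1) flag_cap d k)%VS.
Proof.
apply: directv_sum_nat => -[|i] lt_id; first by rewrite big_ord0 cap0v.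
apply/eqP; rewrite -subv0.
have le_d1d : (d.-1 <= d)%N by apply: leq_pred.
have d1K : d.-1.+1 = d by rewrite prednK // (leq_ltn_trans (leq0n i)).
have sum0 : (\sum_(k < d) flag_cap d.-1 k)%VS = 0%VS.
  by apply: flag_cap_sum_eq0; rewrite ?flag_cap_ge ?d1K.
rewrite -[X in (_ <= X)%VS]sum0.
apply: subv_trans (sumv_sup (Ordinal (lt_id : (i < d)%N)) _ (subvv _)) => //=.
rewrite subv_cap d1K; apply/andP; split.
  exact: subv_trans (capvSr _ _) (capvSl _ _).
exact: subv_trans (capvSl _ _) (flag_cap_sum_sub _ _).
Qed.

Lemma flag_cap_split_decomposition :
  split_decomposition A B (fun i : 'I_d.+1 => a i) (fun i : 'I_d.+1 => b i)
    (fun i : 'I_d.+1 => flag_cap d i).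
Proof.
have extE n : extend0 (fun i : 'I_d.+1 => flag_cap d i) n%:Z = flag_cap d n.
  have [lt_nd|le_dn] := ltnP n d.+1; first exact: (extend0_ord _ (Ordinal lt_nd)).
  by rewrite extend0_gt // flag_cap_ge.
split; first split.
- by move=> i; apply: flag_cap_neq0; rewrite -ltnS.
- exact: flag_cap_sum_full.
- exact: flag_cap_directv.
have le_id (i : 'I_d.+1) : (i <= d)%N by rewrite -ltnS.
move=> i; split.
  have -> : i%:Z + 1 = i.+1%:Z by rewrite intS GRing.addrC.
  by rewrite extE /= subSS flag_cap_up ?le_id /=.
apply: subv_trans (flag_cap_down _) _; first by rewrite le_id /=.
case: i => [[|i] lt_id]; first exact: sub0v.
have -> : i.+1%:Z - 1 = i%:Z by rewrite intS GRing.addrAC GRing.subrr GRing.add0r.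
by rewrite extE.
Qed.

End SplitDecomposition.

Theorem theorem1p7 (K : fieldType) (V : vectType K)
  (V_neq0 : (fullv : {vspace V}) <> 0%VS)
  (d : nat) (A As : 'End(V)) (theta thetas : 'I_d.+1 -> K)
  (A_diag : diagonalizable_end A) (As_diag : diagonalizable_end As)
  (A_eig : has_eigenvalues A theta) (As_eig : has_eigenvalues As thetas)
  (irr : irreducible_pair A As)
  (hess : hessenberg_pair A As theta thetas) :
  exists U : 'I_d.+1 -> {vspace V}, split_decomposition A As theta thetas U.
Proof.
have F_full := eigenflag_full A_diag A_eig.
have inord_rev (i : 'I_d.+1) : inord (d - i) = rev_ord i.
  by apply: val_inj; rewrite /= inordK ?subSS // ltnS leq_subr.
(* [inord] extends the eigenvalues to sequences on the naturals; the shift conditions only concern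
   indices up to [d], where it is faithful. *)
have [||||U_dec U_split] := @flag_cap_split_decomposition K V A As d
  (eigenflag A theta) (eigenflag As thetas)
  (fun n => theta (inord n)) (fun n => thetas (inord n)) irr (eigenflag0 _ _)
  (eigenflag0 _ _) F_full (eigenflag1_neq0 As_eig)
  (fun i => @eigenflag_proper _ _ _ _ _ i As_eig) (@eigenflag_leq _ _ _ A theta)
  (@eigenflag_leq _ _ _ As thetas).
- by move=> i lt_id; have := limg_eigenflag_shift A theta (inord i); rewrite inordK.
- by move=> i lt_id; have := limg_eigenflag_shift As thetas (inord i); rewrite inordK.
- by move=> i; apply: limg_eigenflag => j; have [] := hess j.
- by move=> i; apply: limg_eigenflag => j; have [] := hess j.
exists (fun i : 'I_d.+1 => flag_cap (eigenflag A theta) (eigenflag As thetas) d i).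
split=> // i; have [] := U_split i.
by rewrite /= subSS inord_rev inord_val.
Qed.
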